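(* Let $0\le L\le M$ be integers and let $a_L,a_{L+1},\ldots,a_M$ be independent and identically distributed real random variables (with no further assumption on their common distribution), such that $P\big((a_L,\ldots,a_M)\ne(0,\ldots,0)\big)>0$. Let $C(x)=\sum_{k=L}^{M} a_k\cos(kx)$. Then the expected number of real zeros of $C$ in one period, taken over those $C$ which are not identically zero, is at least $L+M$; that is, $$\mathbb{E}\big[\,Z(C)\,\big|\,C\not\equiv 0\,\big]\ \ge\ L+M .$$
   Context: For a real trigonometric polynomial $f$ that is not identically zero, $Z(f)$ denotes the number of real zeros of $f$ in one period $[0,2\pi)$, counted with multiplicity. The expectation is conditional on the event that $C$ is not identically zero (equivalently, that $(a_L,\ldots,a_M)\neq(0,\ldots,0)$). *)

(* Defs.v *)
From HB Require Import structures.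
From mathcomp Require Import all_boot all_order all_algebra.
From mathcomp Require Import all_classical all_reals all_analysis.

Set Implicit Arguments.
Unset Strict Implicit.
Unset Printing Implicit Defensive.

Import Order.TTheory GRing.Theory Num.Theory.
Import numFieldNormedType.Exports.

Local Open Scope classical_set_scope.
Local Open Scope ring_scope.

(* The supremum of the n such that f, f', ..., f^(n-1) all vanish at x: it is 0
   when f x != 0 and +oo when every derivative vanishes. *)
Definition vanishing_order (R : realType) (f : R -> R) (x : R) : \bar R :=
  ereal_sup [set (n%:R)%:E | n in
    [set n : nat | forall k : nat, (k < n)%N -> derive1n k f x = 0]].

Lemma vanishing_orderE (R : realType) (f : R -> R) (x : R) (m : nat) :
    (forall k : nat, (k < m)%N -> derive1n k f x = 0) -> derive1n m f x <> 0 ->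
  vanishing_order f x = (m%:R)%:E.
Proof.
move=> fm0 fmN0; apply/eqP; rewrite eq_le; apply/andP; split.
  apply: ge_ereal_sup => _ [n fn0 <-].
  by rewrite lee_fin ler_nat leqNgt; apply/negP => /fn0.
by apply: ereal_sup_ubound; exists m.
Qed.

Definition num_zeros (R : realType) (f : R -> R) : \bar R :=
  \esum_(x in [set x : R | 0 <= x < 2 * pi /\ f x = 0]) vanishing_order f x.

Definition cos_poly (R : realType) (L M : nat) (a : nat -> R) (x : R) : R :=
  \sum_(L <= k < M.+1) a k * cos (k%:R * x).

Definition mutually_independent d (T : measurableType d) (R : realType)
    (P : probability T R) (I : choiceType) (D : set I)
    (X : I -> {RV P >-> R}) : Prop :=
  forall (s : seq I) (B : I -> set R),
    uniq s -> (forall i, i \in s -> D i) ->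
    (forall i, i \in s -> measurable (B i)) ->
    (P (\big[setI/setT]_(i <- s) (X i @^-1` B i)) =
     \prod_(i <- s) P (X i @^-1` B i))%E.
Arguments mutually_independent {d T R} P {I} D X.

Definition identically_distributed d (T : measurableType d) (R : realType)
    (P : probability T R) (I : Type) (D : set I)
    (X : I -> {RV P >-> R}) : Prop :=
  forall i j, D i -> D j -> forall B : set R, measurable B ->
    distribution P (X i) B = distribution P (X j) B.
Arguments identically_distributed {d T R} P {I} D X.

Definition cond_expectation d (T : measurableType d) (R : realType)
    (P : probability T R) (X : T -> \bar R) (A : set T) : \bar R :=
  ((\int[P]_(w in A) X w) / P A)%E.

(* Main.v *)
Require Import Defs.
From mathcomp Require Import all_boot all_order all_algebra.
From mathcomp Require Import ring lra zify.
From mathcomp Require Import all_classical all_reals all_analysis.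
From mathcomp Require Import measurable_realfun measurable_fun_approximation.

Set Implicit Arguments.
Unset Strict Implicit.
Unset Printing Implicit Defensive.

Import Order.TTheory GRing.Theory Num.Theory.
Import numFieldNormedType.Exports.

Local Open Scope classical_set_scope.
Local Open Scope ring_scope.

(* Put [N = L + M] and let [C*] be the cosine polynomial with the reversed
   coefficients [a_(N - k)].  At the nodes [x_j = j pi / N], [0 <= j < 2 N],
   one has [C*(x_j) = (-1)^j C(x_j)], so between two consecutive nodes where
   [C] does not vanish exactly one of the sign sequences of [C] and [C*]
   changes sign, while a node where [C] vanishes is a zero of both.  Hence the
   sign changes and zeros of the two sequences number at least [2 N] in total,
   and for each polynomial they are at most its number of zeros.  The i.i.d.
   hypothesis gives [C] and [C*] the same law, so on average each
   has at least [N] of them.  The count depends only on the signs of [C(x_j)], hence is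
   measurable, and no measurability of the number of zeros is needed. *)

(** * Sign changes and zeros of a finite sequence *)

(** Index [j] stands for a half-open interval: a zero at its right end is left to [j.+1]. *)
Definition sign_count (R : realType) (n : nat) (s : nat -> R) : nat :=
  (\sum_(j < n) ((s j * s j.+1 < 0)%R + (s j == 0)%R))%N.

(** Since [t j * t j.+1 = - (s j * s j.+1)], each index has a sign change in [s] or [t], or a zero
    at one of its two ends. By [s n = s 0] right-end zeros are as many as left-end ones, and the
    zeros of [t], being those of [s], account for them. *)
Lemma sign_count_reverse (R : realType) (n : nat) (s t : nat -> R) :
    s n = s 0 -> (forall j, t j = (-1) ^+ j * s j) ->
  (n <= sign_count n s + sign_count n t)%N.
Proof.
move=> sn0 ts.
have zeros_shift :
    (\sum_(j < n) (s j.+1 == 0%R) = \sum_(j < n) (s j == 0%R))%N.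
  apply: (@addnI (s 0%N == 0)).
  rewrite -(big_ord_recl n (fun j => s j == 0 : nat)) big_ord_recr/= sn0.
  exact: addnC.
suff : (n <= \sum_(j < n) ((s j * s j.+1 < 0)%R + (t j * t j.+1 < 0)%R
    + (s j == 0%R) + (s j.+1 == 0%R)))%N.
  rewrite !big_split/= zeros_shift => /leq_trans; apply.
  rewrite /sign_count !big_split/=.
  under [X in (_ <= _ + (_ + X))%N]eq_bigr do rewrite ts mulf_eq0 signr_eq0/=.
  by rewrite [leqRHS]addnACA addnA.
rewrite -[leqLHS]card_ord -sum1_card; apply: leq_sum => j _.
have -> : t j * t j.+1 = - (s j * s j.+1).
  have -> : t j * t j.+1 = ((-1) ^+ j * (-1) ^+ j) * - (s j * s j.+1).
    by rewrite !ts exprS; ring.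
  by rewrite -expr2 sqrr_sign mul1r.
rewrite oppr_lt0.
have : (s j * s j.+1 == 0) = (s j == 0) || (s j.+1 == 0) by rewrite mulf_eq0.
by case: ltgtP => //=; case: eqP; case: eqP.
Qed.

(** * From sign changes to zeros of a continuous function *)

Lemma exists_zero_sign_change (R : realType) (f : R -> R) (x y : R) :
    continuous f -> x < y -> f x * f y < 0 ->
  exists2 z : R, x < z < y & f z = 0.
Proof.
move=> cf xy fxy.
have [fx0 fy0] : f x != 0 /\ f y != 0.
  by apply/andP; rewrite -negb_or -mulf_eq0 lt_eqF.
have [||z] := @IVT R f x y 0 (ltW xy).
- exact: continuous_subspaceT.
- rewrite ge_min le_max.
  case: (ltgtP (f x) 0) fx0 => // fx _; case: (ltgtP (f y) 0) fy0 => // fy _ /=.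
  + by move: fxy; rewrite nmulr_rlt0// ltNge (ltW fy).
  + by move: fxy; rewrite pmulr_rlt0// ltNge (ltW fy).
rewrite in_itv/= => /andP[xz zy] fz; exists z => //; rewrite !lt_neqAle xz zy.
rewrite !andbT; apply/andP; split.
  by apply: contraNneq fx0 => ->; apply/eqP.
by apply: contraNneq fy0 => <-; apply/eqP.
Qed.

Lemma vanishing_order_ge1 (R : realType) (f : R -> R) (x : R) :
  f x = 0 -> (1 <= vanishing_order f x)%E.
Proof.
by move=> fx; apply: ereal_sup_ubound; exists 1%N => //= -[|//] _ /=.
Qed.

Lemma vanishing_order_ge0 (R : realType) (f : R -> R) (x : R) :
  (0 <= vanishing_order f x)%E.
Proof. by apply: ereal_sup_ubound; exists 0%N. Qed.

Lemma num_zeros_ge0 (R : realType) (f : R -> R) : (0 <= num_zeros f)%E.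
Proof. by apply: esum_ge0 => x _; exact: vanishing_order_ge0. Qed.

Lemma num_zeros_ge_size (R : realType) (f : R -> R) (zs : seq R) :
    uniq zs -> {in zs, forall z, 0 <= z < 2 * pi /\ f z = 0} ->
  (((size zs)%:R)%:E <= num_zeros f)%E.
Proof.
move=> uzs zsP; apply: esum_ge; exists [set` zs].
  by split; [exact: finite_seq|move=> z /zsP].
rewrite -fsbig_seq//= -sum1_size natr_sum -sumEFin.
rewrite big_seq [leRHS]big_seq; apply: lee_sum => z /zsP[_ fz].
exact: vanishing_order_ge1.
Qed.

(** Each counted index yields a zero in [[x j, x j.+1[], by the intermediate value theorem or at
    [x j] itself. These intervals are disjoint, so the zeros are distinct, and all lie below
    [2 * pi]. *)
Lemma sign_count_le_num_zeros (R : realType) (f : R -> R) (n : nat)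
    (x : nat -> R) :
    continuous f -> {homo x : i j / (i <= j)%N >-> i <= j} ->
    (forall j, (j < n)%N -> x j < x j.+1) -> 0 <= x 0 -> x n <= 2 * pi ->
  (((sign_count n (f \o x))%:R)%:E <= num_zeros f)%E.
Proof.
move=> cf xle xlt x0 xn.
pose c j := (f (x j) * f (x j.+1) < 0) || (f (x j) == 0).
have /choice[z zP] (j : nat) : exists z : R,
    (j < n)%N -> c j -> x j <= z < x j.+1 /\ f z = 0.
  have [jn|] := boolP (j < n)%N; last by exists 0.
  have [/orP[cj|/eqP cj]|] := boolP (c j); last by exists 0.
  - have [z /andP[z1 z2] fz] := exists_zero_sign_change cf (xlt _ jn) cj.
    by exists z => _ _; rewrite (ltW z1).
  - by exists (x j) => _ _; rewrite lexx xlt.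
have -> : sign_count n (f \o x) =
    size [seq z j | j <- [seq j <- iota 0 n | c j]].
  rewrite size_map size_filter -sum1_count -[n in iota 0 n]subn0 big_mkord.
  rewrite big_mkcond/=; apply: eq_bigr => j _; rewrite /c /=.
  (* The two terms of the count exclude each other: a zero at [x j] makes the product zero, hence
     not negative. *)
  have [->|_] := eqVneq (f (x j)) 0; first by rewrite mul0r ltxx.
  by rewrite orbF addn0; case: ifP.
have mem j : j \in [seq j <- iota 0 n | c j] ->
    x j <= z j < x j.+1 /\ f (z j) = 0.
  by rewrite mem_filter mem_iota add0n/= => /andP[cj jn]; exact: zP.
apply: num_zeros_ge_size.
  rewrite map_inj_in_uniq ?filter_uniq ?iota_uniq// => i j.
  move=> /mem[/andP[i1 i2] _] /mem[/andP[j1 j2] _] zij.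
  have [/xle|/xle|//] := ltngtP i j.
  - by move=> /(lt_le_trans i2); rewrite zij ltNge j1.
  - by move=> /(lt_le_trans j2); rewrite -zij ltNge i1.
move=> _ /mapP[j jc ->]; have [/andP[j1 j2] fz] := mem _ jc; split=> //.
rewrite (le_trans x0 (le_trans (xle _ _ (leq0n j)) j1))/=.
move: jc; rewrite mem_filter mem_iota add0n/= => /andP[_ jn].
exact: lt_le_trans j2 (le_trans (xle _ _ jn) xn).
Qed.

(** * Cosine polynomials: nodes, reversal, uniqueness of coefficients *)

Lemma continuous_cos_poly (R : realType) (L M : nat) (a : nat -> R) :
  continuous (cos_poly L M a).
Proof.
rewrite /cos_poly => x; rewrite /continuous_at.
apply: (cvg_big add_continuous) => k _.
apply: cvgM; first exact: cvg_cst.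
apply: continuous_comp; last exact: continuous_cos.
by apply: cvgM; [exact: cvg_cst|exact: cvg_id].
Qed.

Lemma cos_poly_periodic (R : realType) (L M : nat) (a : nat -> R) :
  periodic (cos_poly L M a) (pi *+ 2).
Proof.
move=> x; apply: eq_bigr => k _; congr (_ * _).
by rewrite mulrDr [X in _ + X]mulr_natl (periodicn (@cosD2pi R)).
Qed.

Definition cos_node (R : realType) (N j : nat) : R := j%:R * pi / N%:R.

(** With [x] the node of index [j], [(L + M) x = j pi], so [cos ((L + M - k) x) = cos (j pi - k x) =
    (-1)^j cos (k x)]. *)
Lemma cos_poly_reverse (R : realType) (L M : nat) (a : nat -> R) (j : nat) :
    (0 < L + M)%N ->
  cos_poly L M (fun k => a (L + M - k)%N) (cos_node R (L + M) j) =
  (-1) ^+ j * cos_poly L M a (cos_node R (L + M) j).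
Proof.
move=> N0; rewrite /cos_poly big_nat_rev/= mulr_sumr !big_nat.
apply: eq_bigr => k /andP[Lk kM].
rewrite addnS subSS subKn; last by lia.
rewrite [RHS]mulrCA; congr (_ * _).
have -> : ((L + M - k)%:R * cos_node R (L + M) j) =
    - (k%:R * cos_node R (L + M) j) + pi *+ j.
  rewrite /cos_node natrB; last by lia.
  rewrite -mulr_natl; field.
  by rewrite -natrD pnatr_eq0 -lt0n.
by rewrite (alternatingn (@cosDpi R)) cosN.
Qed.

Lemma cos_poly_sign_count_le (R : realType) (L M : nat) (a : nat -> R) :
    (0 < L + M)%N ->
  (((sign_count (L + M).*2 (cos_poly L M a \o cos_node R (L + M)))%:R)%:E
     <= num_zeros (cos_poly L M a))%E.
Proof.
move=> N0; have N0' : 0 < (L + M)%:R :> R by rewrite ltr0n.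
apply: sign_count_le_num_zeros.
- exact: continuous_cos_poly.
- move=> i j ij; rewrite ler_pM2r ?invr_gt0// ler_pM2r ?pi_gt0//.
  by rewrite ler_nat.
- move=> j _; rewrite ltr_pM2r ?invr_gt0// ltr_pM2r ?pi_gt0//.
  by rewrite ltr_nat.
- by rewrite /cos_node !mul0r.
- suff -> : cos_node R (L + M) (L + M).*2 = 2 * pi by [].
  rewrite /cos_node -muln2 natrM; field.
  by rewrite -natrD gt_eqF.
Qed.

Lemma cos_poly_sign_count_reverse (R : realType) (L M : nat) (a : nat -> R) :
    (0 < L + M)%N ->
  ((L + M).*2 <=
   sign_count (L + M).*2 (cos_poly L M a \o cos_node R (L + M)) +
   sign_count (L + M).*2
     (cos_poly L M (fun k => a (L + M - k)%N) \o cos_node R (L + M)))%N.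
Proof.
move=> N0; apply: sign_count_reverse => [|j]; last exact: cos_poly_reverse.
rewrite /= -[RHS]cos_poly_periodic; congr cos_poly.
rewrite /cos_node -muln2 natrM; field.
by rewrite -natrD pnatr_eq0 -lt0n.
Qed.

(* Averaging the two translates by [h = pi / M] multiplies the coefficient of
   [cos (k x)] by [cos (k h)], which differs from [cos (M h) = -1] for [k < M]:
   subtracting kills the top term and only that one. *)
Lemma cos_poly_eq0 (R : realType) (L M : nat) (a : nat -> R) :
    (forall x, cos_poly L M a x = 0) ->
  forall k, (L <= k <= M)%N -> a k = 0.
Proof.
elim: M a => [|M IH] a a0 k /andP[Lk kM].
  have k0 : k = 0%N by lia.
  have L0 : L = 0%N by lia.
  by have := a0 0; rewrite /cos_poly k0 L0 big_nat1 mulr0 cos0 mulr1.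
have LM : (L <= M.+1)%N by lia.
have low i : (L <= i <= M)%N -> a i = 0.
  move=> LiM; pose h : R := pi / M.+1%:R.
  have Mh : M.+1%:R * h = pi by rewrite /h mulrC divfK.
  have : a i * (cos (i%:R * h) + 1) = 0.
    apply: (IH (fun j => a j * (cos (j%:R * h) + 1))) => // x.
    have := a0 (x + h); have := a0 (x - h); have := a0 x.
    rewrite /cos_poly !(big_nat_recr M.+1)//=.
    set s0 := \sum_(L <= _ < _) _ => e0; set sm := \sum_(L <= _ < _) _ => em.
    set sp := \sum_(L <= _ < _) _ => ep.
    have -> : \sum_(L <= j < M.+1) a j * (cos (j%:R * h) + 1) * cos (j%:R * x) =
        (sp + sm) / 2 + s0.
      rewrite /sp /sm /s0 -big_split/= mulr_suml -big_split/=.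
      apply: eq_bigr => j _.
      by rewrite (mulrDr j%:R x h) (mulrBr j%:R x h) cosD cosB; field.
    move: em ep; by rewrite mulrBr (mulrDr _ x h) cosB cosD Mh cospi sinpi; lra.
  move/eqP; rewrite mulf_eq0 => /orP[/eqP//|].
  rewrite addr_eq0 -cospi => /eqP E.
  have h0 : 0 < h by rewrite divr_gt0 ?pi_gt0.
  have iM : i%:R < M.+1%:R :> R by rewrite ltr_nat; lia.
  (* [cos] is injective on [[0, pi]], so the factor [cos (i h) + 1] vanishes only if
     [i h = pi = M.+1 h], which [i <= M] forbids. *)
  have : i%:R * h = pi.
    apply: cos_inj => //; rewrite in_itv/= ?pi_ge0 ?lexx//.
    by rewrite mulr_ge0 ?ler0n ?(ltW h0)//= -Mh ler_pM2r// ltW.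
  by rewrite -Mh => /(mulIf (lt0r_neq0 h0)) E'; rewrite E' ltxx in iM.
have [{}kM|kM'] := leqP k M; first by apply: low; rewrite Lk.
have -> : k = M.+1 by lia.
(* With the lower coefficients gone, the value at [0] is the top one. *)
have := a0 0; rewrite /cos_poly big_nat_recr//= mulr0 cos0 mulr1 big_nat big1.
  by rewrite add0r.
by move=> i /low ->; rewrite mul0r.
Qed.

(** * Laws and integrals of i.i.d. tuples *)

Definition tuple_rect (n : nat) (T : Type) (B : 'I_n -> set T) :
    set (n.-tuple T) := [set t | forall i, B i (tnth t i)].

(** Rectangles, unlike preimages under single coordinates, are stable under intersection, as
    uniqueness of measures requires of a generator. *)
Lemma measurable_tupleE d (T : measurableType d) (n : nat) :
  @measurable _ (n.-tuple T) =
  <<s [set A | exists2 B : 'I_n -> set T,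
        forall i, measurable (B i) & A = tuple_rect B] >>.
Proof.
rewrite eqEsubset; split; last first.
  apply: smallest_sub; first exact: sigma_algebra_measurable.
  move=> _ [B mB ->].
  rewrite (_ : tuple_rect B =
      \big[setI/setT]_(i < n) ((@tnth n T)^~ i @^-1` B i)).
    apply: bigsetI_measurable => i _; rewrite -[X in measurable X]setTI.
    exact: measurable_tnth.
  rewrite -bigcap_seq; apply/seteqP; split=> t /= Bt.
    by move=> i _; exact: Bt.
  by move=> i; apply: Bt; rewrite /= mem_index_enum.
apply: smallest_sub; first exact: smallest_sigma_algebra.
rewrite -bigcup_seq => A [i _ [Y mY <-]]; apply: sub_sigma_algebra.
exists (fun k => if k == i then Y else setT); first by move=> k; case: ifP.
rewrite setTI; apply/seteqP; split=> t /=.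
  by move=> Yt k; case: eqP => // ->.
by move=> /(_ i); rewrite eqxx.
Qed.

Definition rv_tuple d (T : measurableType d) (R : realType)
    (P : probability T R) (I : choiceType) (X : I -> {RV P >-> R}) (n : nat)
    (p : 'I_n -> I) (w : T) : n.-tuple R := [tuple X (p i) w | i < n].

Section iid_reindex.
Context d (T : measurableType d) (R : realType) (P : probability T R).
Context (I : choiceType) (D : set I) (X : I -> {RV P >-> R}) (n : nat).

Lemma measurable_rv_tuple (p : 'I_n -> I) :
  measurable_fun setT (rv_tuple X p).
Proof.
apply/measurable_fun_tnthP => i.
rewrite (_ : _ \o _ = X (p i)); first exact: measurable_funP.
by apply/funext => w /=; rewrite tnth_mktuple.
Qed.

Lemma rv_tuple_rect (p : 'I_n -> I) (B : 'I_n -> set R) :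
    mutually_independent P D X -> injective p -> (forall i, D (p i)) ->
    (forall i, measurable (B i)) ->
  P (rv_tuple X p @^-1` tuple_rect B) = (\prod_(i < n) P (X (p i) @^-1` B i))%E.
Proof.
move=> indep pinj pD mB.
(* Independence takes sides indexed by [I]: [B'] carries [B] along the injection [p], with [setT]
   off its image. *)
pose B' k := if [pick i | p i == k] is Some i then B i else setT.
have B'p i : B' (p i) = B i.
  rewrite /B'; case: pickP => [j /eqP/pinj ->//|/(_ i)].
  by rewrite eqxx.
have := indep [seq p i | i <- index_enum 'I_n] B'.
rewrite !big_map map_inj_uniq// index_enum_uniq => /(_ isT) indepE.
under [RHS]eq_bigr do rewrite -B'p.
rewrite -indepE.
- congr (P _); rewrite -bigcap_seq; apply/seteqP; split=> w /= Bw.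
  + by move=> i _; have := Bw i; rewrite tnth_mktuple B'p.
  + move=> i; rewrite tnth_mktuple -B'p; apply: Bw.
    by rewrite /= mem_index_enum.
- by move=> _ /mapP[i _ ->].
- by move=> _ /mapP[i _ ->]; rewrite B'p.
Qed.

(** On rectangles both laws are the same product of marginals; hence they agree on all measurable
    sets, and the integrals agree by pushforward. *)
Lemma iid_integral_rv_tuple (p q : 'I_n -> I) (E : set (n.-tuple R))
    (f : n.-tuple R -> \bar R) :
    mutually_independent P D X -> identically_distributed P D X ->
    injective p -> injective q -> (forall i, D (p i)) -> (forall i, D (q i)) ->
    measurable E -> measurable_fun E f -> (forall t, 0 <= f t)%E ->
  (\int[P]_(w in rv_tuple X p @^-1` E) f (rv_tuple X p w) =
   \int[P]_(w in rv_tuple X q @^-1` E) f (rv_tuple X q w))%E.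
Proof.
move=> indep ident pinj qinj pD qD mE mf f0.
have mp := measurable_rv_tuple p; have mq := measurable_rv_tuple q.
pose G := [set A | exists2 B : 'I_n -> set R,
  forall i, measurable (B i) & A = tuple_rect B].
have pq A : measurable A ->
    pushforward P (rv_tuple X p) A = pushforward P (rv_tuple X q) A.
  apply: (measure_unique G (fun=> setT)).
  - exact: measurable_tupleE.
  - move=> _ _ [B1 mB1 ->] [B2 mB2 ->].
    exists (fun i => B1 i `&` B2 i); first by move=> i; exact: measurableI.
    apply/seteqP; split=> t /=; first by move=> [t1 t2] i; split.
    by move=> t12; split=> i; have [] := t12 i.
  - move=> _; exists (fun=> setT) => //.
    by apply/seteqP; split=> // t _ i.
  - by apply/seteqP; split=> // t _; exists 0%N.
  - move=> _ [B mB ->].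
    apply: (eq_trans (rv_tuple_rect indep pinj pD mB)).
    apply: (eq_trans _ (esym (rv_tuple_rect indep qinj qD mB))).
    by apply: eq_bigr => i _; exact: ident.
  - move=> _; change (P (rv_tuple X p @^-1` setT) < +oo)%E.
    by rewrite preimage_setT probability_setT ltry.
have push r (mr : measurable_fun setT (rv_tuple X r)) :=
  ge0_integral_pushforward mr P mE mf (fun t _ => f0 t).
apply: (eq_trans (esym (push p mp))); apply: (eq_trans _ (push q mq)).
by apply: eq_measure_integral => A mA _; exact: pq.
Qed.

End iid_reindex.

(* [g] need not be measurable: the integral of a nonnegative function is the
   supremum of the integrals of the simple functions below it. *)
Lemma ge0_le_lower_integral d (T : measurableType d) (R : realType)
    (mu : {measure set T -> \bar R}) (D : set T) (f g : T -> \bar R) :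
    (forall x, D x -> 0 <= f x)%E -> (forall x, D x -> f x <= g x)%E ->
  (\int[mu]_(x in D) f x <= \int[mu]_(x in D) g x)%E.
Proof.
move=> f0 fg; rewrite !ge0_integralE//; last first.
  by move=> x Dx; rewrite (le_trans (f0 x Dx))// fg.
apply: ereal_sup_le => _ [h hf <-]; exists h => // x.
by rewrite (le_trans (hf x))//; exact: lee_restrict.
Qed.

(** * Measurability in the coefficients *)

Lemma measurable_natr_bool d (T : measurableType d) (R : realType)
    (b : T -> bool) :
  measurable_fun setT b -> measurable_fun setT (fun t => (b t)%:R : R).
Proof.
move=> mb; rewrite (_ : (fun _ => _) = fun t => if b t then 1 else 0).
  exact: measurable_fun_ifT.
by apply/funext => t; case: (b t).
Qed.

Lemma measurable_sign_count d (T : measurableType d) (R : realType) (n : nat)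
    (s : T -> nat -> R) :
    (forall j, measurable_fun setT (s^~ j)) ->
  measurable_fun setT (fun t => (sign_count n (s t))%:R : R).
Proof.
move=> ms; rewrite /sign_count; under eq_fun do rewrite natr_sum.
apply: measurable_sum => j; under eq_fun do rewrite natrD.
apply: measurable_funD; apply: measurable_natr_bool.
  by apply: measurable_fun_ltr => //; exact: measurable_funM.
exact: measurable_fun_eqr.
Qed.

(* The tuple lists [a_L, ..., a_M]; only the values at [L <= k <= M] matter. *)
Definition tuple_coef (R : realType) (L M : nat) (t : (M.+1 - L).-tuple R)
  (k : nat) : R := nth 0 t (k - L).

Lemma cos_poly_coef_eq (R : realType) (L M : nat) (a b : nat -> R) :
    (forall k, (L <= k <= M)%N -> a k = b k) ->
  cos_poly L M a = cos_poly L M b.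
Proof.
move=> ab; apply/funext => x; rewrite /cos_poly !big_nat.
by apply: eq_bigr => k /ab ->.
Qed.

Lemma measurable_cos_poly_tuple (R : realType) (L M : nat) (x : R) :
  measurable_fun setT (fun t => cos_poly L M (@tuple_coef R L M t) x).
Proof.
apply: measurable_sum => k; apply: measurable_funM => //.
rewrite /tuple_coef; have [kn|nk] := ltnP (k - L) (M.+1 - L).
  under eq_fun do rewrite -(tnth_nth 0 _ (Ordinal kn)).
  exact: measurable_tnth.
under eq_fun do rewrite nth_default ?size_tuple//.
exact: measurable_cst.
Qed.

(** Turns the conditioning event into one on the coefficients, where measurability and invariance
    under reversal are visible. *)
Lemma cos_poly_neq0P (R : realType) (L M : nat) (a : nat -> R) :
  (exists x, cos_poly L M a x <> 0) <->
  (exists k, (L <= k <= M)%N /\ a k <> 0).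
Proof.
split; apply: contraPP => /forallNP a0; apply/forallNP.
  move=> x; apply; rewrite /cos_poly big_nat big1// => k Lk.
  have [->|/eqP ak] := eqVneq (a k) 0; first by rewrite mul0r.
  by case: (a0 k).
move=> k [Lk]; apply; apply: cos_poly_eq0 Lk => x.
exact: contrapT (a0 x).
Qed.

Lemma measurable_tuple_neq0 (R : realType) (n : nat) :
  measurable [set t : n.-tuple R | exists i, tnth t i != 0].
Proof.
rewrite (_ : mkset _ = \big[setU/set0]_(i < n)
    ((@tnth n R)^~ i @^-1` (~` [set 0]))).
  apply: bigsetU_measurable => i _; rewrite -[X in measurable X]setTI.
  by apply: measurable_tnth => //; exact: measurableC.
rewrite -bigcup_seq; apply/seteqP; split=> t /=.
  by move=> [i /eqP ti]; exists i => //=; rewrite mem_index_enum.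
by move=> [i _ /eqP ti]; exists i.
Qed.

(** * The expected number of zeros *)

Theorem theorem1p1 (R : realType) (d : measure_display) (T : measurableType d)
    (P : probability T R) (L M : nat) (a : nat -> {RV P >-> R})
    (leLM : (L <= M)%N)
    (a_indep : mutually_independent P [set k : nat | (L <= k <= M)%N] a)
    (a_ident : identically_distributed P [set k : nat | (L <= k <= M)%N] a)
    (a_neq0 : (0 < P [set w | exists k : nat,
                                (L <= k <= M)%N /\ a k w <> 0%R])%E) :
  let C (w : T) : R -> R := cos_poly L M (fun k => a k w) in
  (((L + M)%:R)%:E <=
     cond_expectation P (fun w => num_zeros (C w))
       [set w | exists x : R, C w x <> 0%R])%E.
Proof.
pose C w := cos_poly L M (fun k => a k w).
pose A := [set w | exists x, C w x <> 0].
change (((L + M)%:R)%:E <= cond_expectation P (fun w => num_zeros (C w)) A)%E.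
have {}a_neq0 : (0 < P A)%E.
  rewrite (_ : A = [set w | exists k : nat, (L <= k <= M)%N /\ a k w <> 0%R])//.
  by apply/seteqP; split=> w /cos_poly_neq0P.
rewrite /cond_expectation.
(* The nodes divide by [L + M]; when it is [0], nonnegativity suffices. *)
have [N0|N_gt0] := posnP (L + M).
  rewrite N0 mule_ge0 ?inve_ge0//.
  by apply: integral_ge0 => w _; exact: num_zeros_ge0.
pose n := (M.+1 - L)%N.
(* [p] lists the indices upwards and [q] downwards, so [q] gives the reversed polynomial. *)
pose p (i : 'I_n) := (L + i)%N; pose q (i : 'I_n) := (M - i)%N.
have pD i : (L <= p i <= M)%N by have := ltn_ord i; rewrite /p /n; lia.
have qD i : (L <= q i <= M)%N by have := ltn_ord i; rewrite /q /n; lia.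
have pinj : injective p by move=> i j /addnI/val_inj.
have qinj : injective q.
  move=> i j qij; apply/val_inj => /=; move: qij.
  by have := ltn_ord i; have := ltn_ord j; rewrite /q /n; lia.
pose v := rv_tuple a p; pose v' := rv_tuple a q.
pose E := [set t : n.-tuple R | exists i, tnth t i != 0].
have mE : measurable E := @measurable_tuple_neq0 R n.
have AvE : A = v @^-1` E.
  apply/seteqP; split=> w.
    move=> /cos_poly_neq0P[k [Lk /eqP ak]].
    have kn : (k - L < n)%N by rewrite /n; lia.
    exists (Ordinal kn); rewrite tnth_mktuple (_ : p _ = k)//= /p /=; lia.
  move=> [i]; rewrite tnth_mktuple => /eqP ai.
  by apply/cos_poly_neq0P; exists (p i).
(* Having a nonzero coefficient does not depend on their order, so conditioning on [A] preserves the
   symmetry. *)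
have Av'E : A = v' @^-1` E.
  apply/seteqP; split=> w.
    move=> /cos_poly_neq0P[k [Lk /eqP ak]].
    have kn : (M - k < n)%N by rewrite /n; lia.
    exists (Ordinal kn); rewrite tnth_mktuple (_ : q _ = k)//= /q /=; lia.
  move=> [i]; rewrite tnth_mktuple => /eqP ai.
  by apply/cos_poly_neq0P; exists (q i).
have Cv w : C w = cos_poly L M (tuple_coef (v w)).
  apply: cos_poly_coef_eq => k Lk.
  have kn : (k - L < n)%N by rewrite /n; lia.
  rewrite /tuple_coef -(tnth_nth 0 _ (Ordinal kn)) tnth_mktuple.
  by congr (a _ w); rewrite /p /=; lia.
have Cv' w : cos_poly L M (fun k => a (L + M - k)%N w) =
    cos_poly L M (tuple_coef (v' w)).
  apply: cos_poly_coef_eq => k Lk.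
  have kn : (k - L < n)%N by rewrite /n; lia.
  rewrite /tuple_coef -(tnth_nth 0 _ (Ordinal kn)) tnth_mktuple.
  by congr (a _ w); rewrite /q /=; lia.
pose f (t : n.-tuple R) : \bar R :=
  ((sign_count (L + M).*2
      (cos_poly L M (tuple_coef t) \o cos_node R (L + M)))%:R)%:E.
have f0 t : (0 <= f t)%E by rewrite lee_fin ler0n.
have mf : measurable_fun setT f.
  apply/measurable_EFinP; apply: measurable_sign_count => j.
  exact: measurable_cos_poly_tuple.
have mA : measurable A.
  by rewrite AvE -[X in measurable X]setTI; exact: measurable_rv_tuple.
have mfv r : measurable_fun A (fun w => f (rv_tuple a r w)).
  apply: (measurable_funS measurableT) => //.
  apply: measurableT_comp => //; exact: measurable_rv_tuple.
have fvv' : (\int[P]_(w in A) f (v w) = \int[P]_(w in A) f (v' w))%E.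
  rewrite {1}AvE Av'E; apply: (iid_integral_rv_tuple a_indep a_ident) => //.
  exact: measurable_funS mf.
have fN w : (((L + M).*2%:R)%:E <= f (v w) + f (v' w))%E.
  rewrite lee_fin -natrD ler_nat -Cv -Cv'.
  exact: cos_poly_sign_count_reverse.
have fPA : P A \is a fin_num by exact: fin_num_measure.
have le_int : (((L + M)%:R)%:E * P A <= \int[P]_(w in A) f (v w))%E.
  have : (((L + M).*2%:R)%:E * P A <=
      \int[P]_(w in A) f (v w) + \int[P]_(w in A) f (v w))%E.
    rewrite {2}fvv' -ge0_integralD//; [|exact: mfv..].
    apply: (@le_trans _ _ (\int[P]_(w in A) ((L + M).*2%:R)%:E)%E).
      by rewrite integral_cst.
    by apply: ge0_le_lower_integral => w _; [rewrite lee_fin ler0n|exact: fN].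
  (* Halving is done in the reals: nonnegativity excludes [-oo], and [+oo] satisfies the bound
     trivially. *)
  have : (0 <= \int[P]_(w in A) f (v w))%E by apply: integral_ge0.
  rewrite -(fineK fPA); case: (integral _ _ _) => [r| |]//=; last first.
    by move=> _ _; rewrite leey.
  rewrite -!EFinM -EFinD !lee_fin -muln2 natrM; lra.
rewrite -(fineK fPA) inver gt_eqF ?fine_gt0 ?a_neq0 ?ltey_eq ?fPA//.
rewrite lee_pdivlMr; last by rewrite fine_gt0// a_neq0 ltey_eq fPA.
rewrite fineK//; apply: (le_trans le_int).
apply: ge0_le_lower_integral => // w _.
by rewrite Cv; exact: cos_poly_sign_count_le.
Qed.
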